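(* Any $\Sigma$-formula $\phi$ is equivalent in $\mathfrak{D}$ to an $\mathcal{L}_{BT}$-formula $\phi'$ of the form $$\phi' \;\equiv\; (\mathbf{Q}_{1}^{t_{1}} v_{1})\ldots(\mathbf{Q}_{m}^{t_{m}} v_{m})\,(s=t)$$ where $t_1,\ldots,t_m,s,t$ are $\mathcal{L}_{BT}$-terms and $\mathbf{Q}_{j}^{t_{j}} v_{j}\in\{\exists v_j,\ \exists v_j\preceq t_j,\ \forall v_j\preceq t_j\}$ for $j=1,\ldots,m$. Moreover, if $\phi$ does not contain bounded universal quantifiers, then $\phi'$ does not contain bounded quantifiers.
   Context: $\mathcal{L}_{BT}$ is the first-order language (with equality) consisting of the constant symbols $e,0,1$, the binary function symbol $\circ$ and one binary relation symbol, written $\preceq$ here. The $\mathcal{L}_{BT}$-structure $\mathfrak{D}$: its universe is the set $\{\boldsymbol{0},\boldsymbol{1}\}^*$ of all finite bit strings, including the empty string $\varepsilon$; $e^{\mathfrak{D}}=\varepsilon$, $0^{\mathfrak{D}}$ is the one-bit string $\boldsymbol{0}$, $1^{\mathfrak{D}}$ is the one-bit string $\boldsymbol{1}$; $\circ^{\mathfrak{D}}$ is concatenation; and $u \preceq^{\mathfrak{D}} v$ iff $u$ is a prefix of $v$, i.e. iff there exists a bit string $x$ with $ux=v$. Bounded quantifiers: $(\exists x\preceq t)\alpha$ abbreviates $(\exists x)[x\preceq t\wedge\alpha]$ and $(\forall x\preceq t)\alpha$ abbreviates $(\forall x)[x\preceq t\rightarrow\alpha]$, where $x$ does not occur in the term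 $t$. The $\Sigma$-formulas are defined inductively: $\alpha$ and $\neg\alpha$ are $\Sigma$-formulas if $\alpha$ is of the form $s\preceq t$ or $s=t$ for terms $s,t$; $\alpha\vee\beta$ and $\alpha\wedge\beta$ are $\Sigma$-formulas if $\alpha,\beta$ are; $(\exists x\preceq t)\alpha$, $(\forall x\preceq t)\alpha$ and $(\exists x)\alpha$ are $\Sigma$-formulas if $\alpha$ is. Two formulas $\phi,\phi'$ are equivalent in $\mathfrak{D}$ if $\mathfrak{D}\models\phi\leftrightarrow\phi'$, i.e. the equivalence holds under every assignment of bit strings to the free variables. *)

(* Defs.v *)
From mathcomp Require Import all_boot.

Set Implicit Arguments.
Unset Strict Implicit.
Unset Printing Implicit Defensive.

Inductive term : Type :=
  | Var of nat
  | Cst_e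
  | Cst_0
  | Cst_1
  | Conc of term & term.

Fixpoint occurs (x : nat) (t : term) : bool :=
  match t with
  | Var y => x == y
  | Cst_e | Cst_0 | Cst_1 => false
  | Conc t1 t2 => occurs x t1 || occurs x t2
  end.

Inductive formula : Type :=
  | Eq of term & term
  | Prec of term & term
  | Neg of formula
  | And of formula & formula
  | Or of formula & formula
  | Imp of formula & formula
  | Ex of nat & formula
  | All of nat & formula.

(* Abbreviations; the side condition that [x] does not occur in [t] is imposed
   wherever they are used as bounded quantifiers. *)
Definition BEx (x : nat) (t : term) (a : formula) : formula :=
  Ex x (And (Prec (Var x) t) a).
Definition BAll (x : nat) (t : term) (a : formula) : formula :=
  All x (Imp (Prec (Var x) t) a).

Inductive Sigma : formula -> Prop :=
  | Sigma_Prec s t : Sigma (Prec s t)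
  | Sigma_Eq s t : Sigma (Eq s t)
  | Sigma_NegPrec s t : Sigma (Neg (Prec s t))
  | Sigma_NegEq s t : Sigma (Neg (Eq s t))
  | Sigma_Or a b : Sigma a -> Sigma b -> Sigma (Or a b)
  | Sigma_And a b : Sigma a -> Sigma b -> Sigma (And a b)
  | Sigma_BEx x t a : ~~ occurs x t -> Sigma a -> Sigma (BEx x t a)
  | Sigma_BAll x t a : ~~ occurs x t -> Sigma a -> Sigma (BAll x t a)
  | Sigma_Ex x a : Sigma a -> Sigma (Ex x a).

Record structure : Type := Structure {
  carrier :> Type;
  i_e : carrier;
  i_0 : carrier;
  i_1 : carrier;
  i_conc : carrier -> carrier -> carrier;
  i_prec : carrier -> carrier -> Prop
}.

Definition update (T : Type) (v : nat -> T) (x : nat) (d : T) : nat -> T :=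
  fun y => if y == x then d else v y.

Fixpoint eval (M : structure) (v : nat -> M) (t : term) : M :=
  match t with
  | Var x => v x
  | Cst_e => i_e M
  | Cst_0 => i_0 M
  | Cst_1 => i_1 M
  | Conc t1 t2 => i_conc (eval v t1) (eval v t2)
  end.

Fixpoint sat (M : structure) (v : nat -> M) (a : formula) : Prop :=
  match a with
  | Eq s t => eval v s = eval v t
  | Prec s t => i_prec (eval v s) (eval v t)
  | Neg b => ~ sat v b
  | And b c => sat v b /\ sat v c
  | Or b c => sat v b \/ sat v c
  | Imp b c => sat v b -> sat v c
  | Ex x b => exists d : M, sat (update v x d) b
  | All x b => forall d : M, sat (update v x d) b
  end.

(* The bits 0 and 1 are [false] and [true]; by [prefixP], [prefix u w] holds iff
   [w = u ++ x] for some [x]. *)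
Definition D : structure :=
  @Structure (seq bool) [::] [:: false] [:: true]
    (fun u w => u ++ w) (fun u w => prefix u w).

Definition equivalent_in (M : structure) (a b : formula) : Prop :=
  forall v : nat -> M, sat v a <-> sat v b.

Fixpoint subformula (b a : formula) : Prop :=
  b = a \/
  match a with
  | Eq _ _ | Prec _ _ => False
  | Neg c | Ex _ c | All _ c => subformula b c
  | And c d | Or c d | Imp c d => subformula b c \/ subformula b d
  end.

(* Bounded quantifiers being abbreviations, a formula contains one when some
   subformula has the abbreviated shape. *)
Definition contains_bounded_ex (a : formula) : Prop :=
  exists (x : nat) (t : term) (b : formula),
    ~~ occurs x t /\ subformula (BEx x t b) a.

Definition contains_bounded_all (a : formula) : Prop :=
  exists (x : nat) (t : term) (b : formula),
    ~~ occurs x t /\ subformula (BAll x t b) a.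

Definition contains_bounded_quantifier (a : formula) : Prop :=
  contains_bounded_ex a \/ contains_bounded_all a.

Inductive quantifier : Type :=
  | QEx of nat
  | QBEx of nat & term
  | QBAll of nat & term.

Definition quantifier_wf (q : quantifier) : bool :=
  match q with
  | QEx _ => true
  | QBEx x t | QBAll x t => ~~ occurs x t
  end.

Definition quantify (q : quantifier) (a : formula) : formula :=
  match q with
  | QEx x => Ex x a
  | QBEx x t => BEx x t a
  | QBAll x t => BAll x t a
  end.

Definition quantified_equation (a : formula) : Prop :=
  exists (qs : seq quantifier) (s t : term),
    all quantifier_wf qs /\ a = foldr quantify (Eq s t) qs.

(* Main.v *)
Require Import Defs.
From mathcomp Require Import all_boot zify.
From Stdlib Require Import Classical.

Set Implicit Arguments.
Unset Strict Implicit.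
Unset Printing Implicit Defensive.

(** Why the theorem holds.  Two equations hold together iff one does:
    [s = t /\ u = w] iff [s0us1u = t0wt1w], since a length count splits the long
    equation into [s0u = t0w] and [s1u = t1w], and the two different separators
    then force [s] and [t] to have the same length
    ([two_equations_as_one]).

    A disjunction of two equations is an existentially quantified system.  The
    equation [ab = 1] makes one of [a], [b] the letter 1 and the other empty, and
    [aqr = qra] then says nothing about [q] and [r] if [a] is empty but puts them
    in 1* if [a = 1].  The equation [0s0q = r0t0] has the solution [q = 0t0],
    [r = 0s0] whatever [s] and [t] are, while solutions in 1* exist only if
    [s = t].  So [ab = 1] selects which of two such equations is enforced
    ([disjunction_as_system]).

    With these two facts, a formula built from equations by conjunction,
    disjunction, [Ex] and [BAll] is brought to the required form by renaming bound
    variables apart and pulling the quantifiers out.  A bounded universal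
    quantifier can be pulled out of a conjunction because its range contains the
    empty word ([positive_prenexable]).

    The other constructs of Sigma-formulas reduce to these without new universal
    quantifiers: [s] is a prefix of [t] iff [sx = t] for some [x]; it is not a
    prefix of [t] iff [s] and some extension of [t] differ at some position; and
    [s], [t] differ iff one of them is not a prefix of the other
    ([Sigma_positivable]).  Hence bounded universal quantifiers appear in the
    result only if the given formula has some, and bounded existential ones never
    do. *)

Local Notation "s @@ t" := (Conc s t) (at level 45, right associativity).
Local Notation word := (seq bool).
Local Notation valuation := (nat -> D).

Lemma ex_iff A (P Q : A -> Prop) : (forall x, P x <-> Q x) ->
  (exists x, P x) <-> (exists x, Q x).
Proof. by move=> PQ; split=> -[x /PQ]; exists x. Qed.

(** * Equations between words *)

(** The two sides split in the middle, by length.  In the resulting pair of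
    equations [s0u = t0w] and [s1u = t1w], a difference in length between [s] and
    [t] would put both separators at the same place of the longer one. *)
Lemma two_equations_as_one (s t u w : word) :
  s ++ false :: u ++ s ++ true :: u = t ++ false :: w ++ t ++ true :: w <->
  s = t /\ u = w.
Proof.
split=> [E | [-> ->] //].
have [E0 E1] : s ++ false :: u = t ++ false :: w /\
    s ++ true :: u = t ++ true :: w.
  have sz : size (s ++ false :: u) = size (t ++ false :: w).
    by move: (congr1 size E); do 3!rewrite ?size_cat /=; lia.
  move/eqP: E; rewrite -!cat_cons !catA.
  rewrite -(catA (s ++ _)) -(catA (t ++ _)) eqseq_cat //.
  by case/andP=> /eqP -> /eqP ->.
elim: s t E0 E1 {E} => [|c s IHs] [|d t] /=.
- by case.
- by case=> <- _ [].
- by case=> -> _ [].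
by case=> -> E0 [E1]; have [-> ->] := IHs _ E0 E1.
Qed.

Lemma commutes_with_one (z : word) : true :: z = z ++ [:: true] -> all id z.
Proof. by elim: z => //= c z IHz [<-] /IHz. Qed.

(** The right-hand side starts with the first letter of [r], if any, and the
    left-hand side ends with the last letter of [q], if any; both would be 1 and
    face a 0. *)
Lemma locked_equation (s t q r : word) : all id (q ++ r) ->
  false :: s ++ false :: q = r ++ false :: t ++ [:: false] -> s = t.
Proof.
rewrite all_cat; case: r => [|c r] /andP[q1].
  move=> _ /= -[].
  case/lastP: q q1 => [|q c].
    by rewrite !cats1 => _ /rcons_inj [].
  rewrite all_rcons => /andP[c1 _].
  by rewrite -rcons_cons -rcons_cat cats1 => /rcons_inj [_ c0]; rewrite c0 in c1.
by move=> /andP[c1 _] /= [c0]; rewrite -c0 in c1.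
Qed.

(** The words [a] and [b] select the equation to be enforced: commuting with
    [a = 1] locks [q] and [r] into 1*, commuting with the empty word leaves them
    free to take the values [0t0] and [0s0]. *)
Lemma disjunction_as_system (s t u w : word) :
  s = t \/ u = w <->
  exists a b q r q' r' : word,
    [/\ a ++ b = [:: true], a ++ q ++ r = q ++ r ++ a,
        b ++ q' ++ r' = q' ++ r' ++ b,
        false :: s ++ false :: q = r ++ false :: t ++ [:: false] &
        false :: u ++ false :: q' = r' ++ false :: w ++ [:: false]].
Proof.
split.
  case=> <-.
    exists [:: true], [::], [::], [::], (false :: w ++ [:: false]),
      (false :: u ++ [:: false]); split=> //=; first by rewrite cats0.
    by rewrite -catA.
  exists [::], [:: true], (false :: t ++ [:: false]), (false :: s ++ [:: false]),
    [::], [::]; split=> //=; first by rewrite cats0.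
  by rewrite -catA.
move=> [[|c [|d a]]] [b] [q] [r] [q'] [r'] [//= E Ea Eb Es Eu].
  right; apply: (locked_equation _ Eu); apply: commutes_with_one.
  by rewrite -catA; rewrite E in Eb.
case: E => Ec _; left; apply: (locked_equation _ Es); apply: commutes_with_one.
by rewrite -catA; rewrite Ec in Ea.
Qed.

(** Extending [t] by [w] avoids a separate case for [t] a proper prefix of [s]:
    [w] is then chosen to disagree with the next letter of [s]. *)
Lemma not_prefixP (s t : word) :
  ~ prefix s t <->
  exists x y z w : word,
    (s = x ++ false :: y /\ t ++ w = x ++ true :: z) \/
    (s = x ++ true :: y /\ t ++ w = x ++ false :: z).
Proof.
split.
  elim: s t => [|c s IHs] [|d t]; rewrite ?prefix0s ?prefix_cons //.
    move=> _; exists [::], s, [::], [:: ~~ c].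
    by case: c => /=; [right | left].
  have [<- /= /IHs | ] := eqVneq c d.
    move=> [x [y [z [w H]]]]; exists (c :: x), y, z, w.
    by case: H => -[-> /= ->]; [left | right].
  move=> ncd _; exists [::], s, t, [::]; rewrite cats0.
  by case: c d ncd => -[] //= _; [right | left].
move=> [x [y [z [w H]]]] /prefixP[r Er]; rewrite {}Er in H.
by case: H => -[->]; rewrite -!catA => /eqP;
  rewrite eqseq_cat // eqxx.
Qed.

(** * Variables occurring in terms *)

Fixpoint below (n : nat) (t : term) : bool :=
  match t with
  | Var x => x < n
  | Cst_e | Cst_0 | Cst_1 => true
  | s @@ t => below n s && below n t
  end.

Lemma below_le n m t : n <= m -> below n t -> below m t.
Proof.
move=> nm; elim: t => //= [x xn | s IHs t IHt /andP[/IHs -> /IHt //]].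
exact: leq_trans nm.
Qed.

Lemma exists_below t : exists n, below n t.
Proof.
elim: t => [x|||| s [n bs] t [m bt]]; try by exists 0.
  by exists x.+1 => /=.
by exists (maxn n m);
  rewrite /= (below_le (leq_maxl n m) bs) (below_le (leq_maxr n m) bt).
Qed.

Lemma eval_eq_below n t (v v' : valuation) : below n t ->
  (forall x, x < n -> v x = v' x) -> eval v t = eval v' t.
Proof.
by move=> + vv'; elim: t => //= s IHs t IHt /andP[/IHs -> /IHt ->].
Qed.

Lemma eval_update n t (v : valuation) x (d : D) : below n t -> n <= x ->
  eval (update v x d) t = eval v t.
Proof.
move=> bt nx; apply: (eval_eq_below bt) => y yn.
by rewrite /update ltn_eqF // (leq_trans yn).
Qed.

Lemma update_eq (v : valuation) x (d : D) : update v x d x = d.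
Proof. by rewrite /update eqxx. Qed.

Lemma update_lt (v : valuation) x (d : D) y : y < x -> update v x d y = v y.
Proof. by move=> yx; rewrite /update ltn_eqF. Qed.

Lemma not_occurs_below n t x : below n t -> n <= x -> ~~ occurs x t.
Proof.
elim: t => //= [y yn nx | s IHs t IHt /andP[bs bt] nx].
  by rewrite gtn_eqF // (leq_trans yn).
by rewrite negb_or IHs // IHt.
Qed.

Fixpoint rename (r : nat -> nat) (t : term) : term :=
  match t with
  | Var x => Var (r x)
  | Cst_e => Cst_e
  | Cst_0 => Cst_0
  | Cst_1 => Cst_1
  | s @@ t => rename r s @@ rename r t
  end.

Lemma eval_rename (v : valuation) r t : eval v (rename r t) = eval (v \o r) t.
Proof. by elim: t => //= s -> t ->. Qed.

Lemma below_rename n m r t : (forall x, x < n -> r x < m) ->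
  below n t -> below m (rename r t).
Proof. by move=> rP; elim: t => //= s IHs t IHt /andP[/IHs -> /IHt ->]. Qed.

(** * Quantifier prefixes *)

Definition qvar (q : quantifier) : nat :=
  match q with QEx x | QBEx x _ | QBAll x _ => x end.

Definition is_QEx (q : quantifier) : bool := if q is QEx _ then true else false.

Definition independent (x : nat) (a : formula) : Prop :=
  forall (v : valuation) (d : D), sat (update v x d) a <-> sat v a.

Lemma foldr_quantify_equiv qs a b : equivalent_in D a b ->
  equivalent_in D (foldr quantify a qs) (foldr quantify b qs).
Proof.
move=> ab; elim: qs => //= q qs IH v; case: q => [x | x t | x t] /=.
- by split=> -[d /IH]; exists d.
- by split=> -[d [? /IH]]; exists d.
- by split=> H d /H /IH.
Qed.

Lemma prefix_update_nil (v : valuation) x (s : word) :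
  prefix (update v x ([::] : D) x) s.
Proof. by rewrite /update eqxx prefix0s. Qed.

(** The common features of conjunction and disjunction that allow a quantifier
    prefix to be pulled out of either operand; [R] is the meaning of the
    connective [op]. *)
Record distributive (R : Prop -> Prop -> Prop)
    (op : formula -> formula -> formula) : Prop := Distributive {
  op_sat : forall (v : valuation) a b, sat v (op a b) <-> R (sat v a) (sat v b);
  op_iff : forall A A' B B', (A <-> A') -> (B <-> B') -> R A B <-> R A' B';
  op_sym : forall A B, R A B <-> R B A;
  op_quantify : forall q a b, independent (qvar q) b ->
    equivalent_in D (op (quantify q a) b) (quantify q (op a b))
}.

Lemma distributive_And : distributive and And.
Proof.
split=> [// | A A' B B' -> -> // | A B | q a b ind v] /=; first by split=> -[].
case: q ind => [x | x t | x t] /= ind; split.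
- by move=> [[d ad] bv]; exists d; rewrite ind.
- by move=> [d []]; rewrite ind => ad bv; split=> //; exists d.
- by move=> [[d [dt ad]] bv]; exists d; rewrite ind.
- by move=> [d [dt []]]; rewrite ind => ad bv; split=> //; exists d.
- by move=> [H bv] d /H; rewrite ind.
- move=> H; split=> [d /H [] //|].
  (* The operand free of the quantified variable is read off at the empty word,
     which satisfies every bound. *)
  by have [] := H [::] (prefix_update_nil _ _ _); rewrite ind.
Qed.

Lemma distributive_Or : distributive or Or.
Proof.
split=> [// | A A' B B' -> -> // | A B | q a b ind v] /=.
  by split=> -[]; [right | left | right | left].
case: q ind => [x | x t | x t] /= ind; split.
- move=> [[d ad] | bv]; first by exists d; left.
  by exists [::]; right; rewrite ind.
- by move=> [d [ad | ]]; [left; exists d | rewrite ind; right].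
- move=> [[d [dt ad]] | bv]; first by exists d; split=> //; left.
  by exists [::]; split; [exact: prefix_update_nil | right; rewrite ind].
- by move=> [d [dt [ad | ]]]; [left; exists d | rewrite ind; right].
- by move=> [H d /H | bv d _]; [left | right; rewrite ind].
(* This direction is classical: the second disjunct must be decided first. *)
- move=> H; have [bv | nbv] := classic (sat v b); first by right.
  by left=> d /H; rewrite ind => -[].
Qed.

Lemma op_prefix R op n qs a b : distributive R op ->
  all (fun q => n <= qvar q) qs -> (forall x, n <= x -> independent x b) ->
  equivalent_in D (op (foldr quantify a qs) b) (foldr quantify (op a b) qs).
Proof.
move=> opP + ind; elim: qs => //= q qs IH /andP[nq fresh] v.
rewrite (op_quantify opP); last exact: ind.
exact: (foldr_quantify_equiv [:: q]) (IH fresh) v.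
Qed.

(** * Predicates defined by a quantified equation *)

(** The bound variables of the prefix lie at or above [n], so that they avoid
    those on which [P] depends, and the variables of the matrix lie below [k], so
    that a second prefix can be chosen above [k] without capturing them. *)
Record prenex (b : bool) (n k : nat) (P : valuation -> Prop)
    (qs : seq quantifier) (s t : term) : Prop := Prenex {
  prenex_wf : all quantifier_wf qs;
  prenex_fresh : all (fun q => n <= qvar q) qs;
  prenex_le : n <= k;
  prenex_below : below k s && below k t;
  prenex_ex : b || all is_QEx qs;
  prenex_spec : forall v, P v <-> sat v (foldr quantify (Eq s t) qs)
}.

Definition prenexable (b : bool) (n : nat) (P : valuation -> Prop) : Prop :=
  exists k qs s t, prenex b n k P qs s t.

Lemma prenexable_iff b n P Q : (forall v, P v <-> Q v) ->
  prenexable b n P -> prenexable b n Q.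
Proof.
move=> PQ [k [qs [s [t [? ? ? ? ? spec]]]]]; exists k, qs, s, t; split=> // v.
by rewrite -PQ.
Qed.

Lemma prenexable_Eq b n s t : below n s -> below n t ->
  prenexable b n (fun v => eval v s = eval v t).
Proof. by exists n, [::], s, t; split; rewrite ?orbT //; apply/andP. Qed.

Lemma prenexable_prefix b n k qs a :
  all quantifier_wf qs -> all (fun q => n <= qvar q) qs -> b || all is_QEx qs ->
  n <= k -> prenexable b k (fun v => sat v a) ->
  prenexable b n (fun v => sat v (foldr quantify a qs)).
Proof.
move=> wf fresh ex nk [k' [qs' [s [t [wf' fresh' le bst ex' spec]]]]].
exists k', (qs ++ qs'), s, t; split; rewrite ?all_cat ?wf ?fresh //=.
- by apply: sub_all fresh' => q' /=; exact: leq_trans.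
- exact: leq_trans le.
- by move: ex ex'; case: (b) => //= -> ->.
- by move=> v; rewrite foldr_cat; apply: foldr_quantify_equiv.
Qed.

Lemma prenexable_quantify b n q P :
  quantifier_wf q -> qvar q = n -> b || is_QEx q -> prenexable b n.+1 P ->
  exists a, (forall v, P v <-> sat v a) /\
    prenexable b n (fun v => sat v (quantify q a)).
Proof.
move=> wf qn bq exP; have [k [qs [s [t [_ _ _ _ _ spec]]]]] := exP.
exists (foldr quantify (Eq s t) qs); split=> //.
apply: (@prenexable_prefix _ n n.+1 [:: q]); rewrite /= ?wf ?qn ?leqnn ?andbT //.
exact: prenexable_iff exP.
Qed.

Lemma prenexable_exists b n P : prenexable b n.+1 P ->
  prenexable b n (fun v => exists d : D, P (update v n d)).
Proof.
case/(@prenexable_quantify b n (QEx n)) => // [|a [Pa]]; first by rewrite orbT.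
by apply: prenexable_iff => v; split=> -[d /Pa]; exists d.
Qed.

Lemma prenexable_forall (b : bool) n t P : b -> below n t ->
  prenexable b n.+1 P ->
  prenexable b n
    (fun v => forall d : D, prefix d (eval v t) -> P (update v n d)).
Proof.
move=> hb bt /(@prenexable_quantify b n (QBAll n t)).
case=> //= [||a [Pa]]; [exact: not_occurs_below bt _ | by rewrite hb |].
apply: prenexable_iff => v; split=> H d.
  by move=> dt; apply/Pa/H; rewrite update_eq (eval_update _ _ bt).
by rewrite update_eq (eval_update _ _ bt) // => /H /Pa.
Qed.

Definition supported (n : nat) (P : valuation -> Prop) : Prop :=
  forall v v' : valuation, (forall x, x < n -> v x = v' x) -> P v <-> P v'.

(** The prefix of [Q] is chosen beyond all variables of the matrix of [P]; the
    prefixes are then pulled out one after the other, and what remains is the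
    connective applied to two equations.  That [Q] does not depend on the
    variables bound in the prefix of [P] is known from [supported]. *)
Lemma prenexable_op R op b n P Q : distributive R op ->
  (forall k s t u w, below k s -> below k t -> below k u -> below k w ->
     prenexable b k (fun v => sat v (op (Eq s t) (Eq u w)))) ->
  prenexable b n P ->
  supported n Q -> (forall m, n <= m -> prenexable b m Q) ->
  prenexable b n (fun v => R (P v) (Q v)).
Proof.
move=> opP opE [k [qs [s [t [wf fresh nk /andP[bs bt] ex spec]]]]] suppQ exQ.
have [m [qs' [u [w [wf' fresh' km /andP[bu bw] ex' spec']]]]] := exQ k nk.
have opC a c : equivalent_in D (op a c) (op c a).
  by move=> v; rewrite !(op_sat opP); exact: op_sym opP _ _.
have exE : prenexable b n (fun v =>
    sat v (foldr quantify (op (Eq s t) (Eq u w)) (qs ++ qs'))).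
  apply: (@prenexable_prefix _ _ m); rewrite ?all_cat ?wf ?fresh //=.
  - by apply: sub_all fresh' => q /=; exact: leq_trans.
  - by move: ex ex'; case: (b) => //= -> ->.
  - exact: leq_trans km.
  - by apply: opE => //; exact: below_le km _.
apply: prenexable_iff exE => v; rewrite foldr_cat.
have -> : R (P v) (Q v) <-> sat v (op (foldr quantify (Eq s t) qs)
                                      (foldr quantify (Eq u w) qs')).
  by rewrite (op_sat opP); apply: op_iff opP _ _ _ _ _ _; rewrite -?spec -?spec'.
rewrite (op_prefix _ opP fresh); last first.
  move=> x nx v' d; rewrite -!spec'; apply: suppQ => y yn.
  by rewrite /update ltn_eqF // (leq_trans yn).
apply: foldr_quantify_equiv => {}v; rewrite (opC (Eq s t)).
rewrite (op_prefix _ opP fresh'); last first.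
  by move=> x kx v' d /=; rewrite !(eval_update _ _ _ kx).
by apply: foldr_quantify_equiv => {}v; exact: opC.
Qed.

Lemma prenexable_And_Eq b k s t u w :
  below k s -> below k t -> below k u -> below k w ->
  prenexable b k (fun v => sat v (And (Eq s t) (Eq u w))).
Proof.
move=> bs bt bu bw.
apply: (prenexable_iff _ (@prenexable_Eq b k (s @@ Cst_0 @@ u @@ s @@ Cst_1 @@ u)
  (t @@ Cst_0 @@ w @@ t @@ Cst_1 @@ w) _ _)) => [v||] /=.
- exact: two_equations_as_one.
- by rewrite bs bu.
- by rewrite bt bw.
Qed.

Lemma prenexable_And b n P Q : prenexable b n P ->
  supported n Q -> (forall m, n <= m -> prenexable b m Q) ->
  prenexable b n (fun v => P v /\ Q v).
Proof.
by apply: prenexable_op distributive_And _ => k s t u w; exact: prenexable_And_Eq.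
Qed.

Lemma prenexable_system b n (es : seq (term * term)) :
  all (fun e => below n e.1 && below n e.2) es ->
  prenexable b n
    (fun v => foldr (fun e A => eval v e.1 = eval v e.2 /\ A) True es).
Proof.
elim: es n => [|[s t] es IH] n /=.
  move=> _; apply: prenexable_iff (@prenexable_Eq b n Cst_e Cst_e _ _) => //.
move=> /andP[/andP[bs bt] bes]; apply: prenexable_And.
- exact: prenexable_Eq.
- move=> v v' vv' {IH}; elim: es bes => //= -[u w] es IH /andP[/andP[bu bw] /IH ->].
  by rewrite (eval_eq_below bu vv') (eval_eq_below bw vv').
- move=> m nm; apply: IH; apply: sub_all bes => e /andP[? ?].
  by apply/andP; split; exact: below_le nm _.
Qed.

Lemma prenexable_Or_Eq b k s t u w :
  below k s -> below k t -> below k u -> below k w ->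
  prenexable b k (fun v => sat v (Or (Eq s t) (Eq u w))).
Proof.
move=> bs bt bu bw.
pose X i := Var (k + i).
pose es := [::
  (X 0 @@ X 1, Cst_1);
  (X 0 @@ X 2 @@ X 3, X 2 @@ X 3 @@ X 0);
  (X 1 @@ X 4 @@ X 5, X 4 @@ X 5 @@ X 1);
  (Cst_0 @@ s @@ Cst_0 @@ X 2, X 3 @@ Cst_0 @@ t @@ Cst_0);
  (Cst_0 @@ u @@ Cst_0 @@ X 4, X 5 @@ Cst_0 @@ w @@ Cst_0)].
have bes : all (fun e => below (k + 6) e.1 && below (k + 6) e.2) es.
  have bk r : below k r -> below (k + 6) r by apply: below_le; exact: leq_addr.
  by rewrite /= !ltn_add2l !bk.
have := prenexable_system b bes.
do 6![rewrite addnS => /prenexable_exists]; rewrite addn0.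
apply: prenexable_iff => v; rewrite /= disjunction_as_system.
do 6!apply: (ex_iff) => ?.
rewrite !(eval_update _ _ bs, eval_update _ _ bt, eval_update _ _ bu,
  eval_update _ _ bw); try lia.
rewrite !addnS addn0 !(update_eq, update_lt); try lia.
by split=> [[? [? [? [? []]]]] | []].
Qed.

Lemma prenexable_Or b n P Q : prenexable b n P ->
  supported n Q -> (forall m, n <= m -> prenexable b m Q) ->
  prenexable b n (fun v => P v \/ Q v).
Proof.
by apply: prenexable_op distributive_Or _ => k s t u w; exact: prenexable_Or_Eq.
Qed.

(** * Positive formulas *)

Inductive positive (n : nat) (b : bool) : formula -> Prop :=
  | positive_Eq s t : below n s -> below n t -> positive n b (Eq s t)
  | positive_And a c : positive n b a -> positive n b c ->
      positive n b (And a c)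
  | positive_Or a c : positive n b a -> positive n b c -> positive n b (Or a c)
  | positive_Ex x a : x < n -> positive n b a -> positive n b (Ex x a)
  | positive_BAll x t a : b -> x < n -> ~~ occurs x t -> below n t ->
      positive n b a -> positive n b (BAll x t a).

Lemma positive_mono n m b a : n <= m -> positive n b a -> positive m b a.
Proof.
move=> nm; elim=> {a} [s t bs bt | a c _ IHa _ IHc | a c _ IHa _ IHc
  | x a xn _ IH | x t a hb xn xt bt _ IH].
- by apply: positive_Eq; exact: below_le nm _.
- exact: positive_And.
- exact: positive_Or.
- by apply: positive_Ex => //; exact: leq_trans nm.
- by apply: positive_BAll => //; [exact: leq_trans nm | exact: below_le nm _].
Qed.

Lemma positive_supported n b a : positive n b a ->
  supported n (fun v => sat v a).
Proof.
elim=> {a} [s t bs bt | a c _ IHa _ IHc | a c _ IHa _ IHc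
  | x a xn _ IH | x t a tb xn xt bt _ IH] v v' vv' /=.
- by rewrite (eval_eq_below bs vv') (eval_eq_below bt vv').
- by rewrite (IHa _ _ vv') (IHc _ _ vv').
- by rewrite (IHa _ _ vv') (IHc _ _ vv').
- have uu' d : sat (update v x d) a <-> sat (update v' x d) a.
    by apply: IH => y yn; rewrite /update; case: eqP => // _; exact: vv'.
  by split=> -[d /uu']; exists d.
- have uu' d y : y < n -> update v x d y = update v' x d y.
    by move=> yn; rewrite /update; case: eqP => // _; exact: vv'.
  by split=> H d; move: (H d); rewrite (eval_eq_below bt (uu' d)) (uu' d) //
    (IH _ _ (uu' d)).
Qed.

Lemma eval_update_not_occurs (v : valuation) x (d : D) t : ~~ occurs x t ->
  eval (update v x d) t = eval v t.
Proof.
elim: t => //= [y | s IHs t IHt].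
  by rewrite /update eq_sym => /negbTE ->.
by rewrite negb_or => /andP[/IHs -> /IHt ->].
Qed.

(** The renaming [r] of the variables is what makes the induction work: passing
    under a quantifier sends its variable to the fresh [n], and replacing [n] by a
    larger number is always possible, so that the prefix of one subformula can
    avoid the variables in the matrix of another. *)
Lemma positive_prenexable N b a : positive N b a ->
  forall r n, (forall x, x < N -> r x < n) ->
  prenexable b n (fun v => sat (v \o r : valuation) a).
Proof.
have supp c r n : positive N b c -> (forall x, x < N -> r x < n) ->
    supported n (fun v => sat (v \o r : valuation) c).
  move=> pc rn v v' vv'; apply: positive_supported pc _ _ _ => x xN.
  by apply: vv'; exact: rn.
have fresh r n x : (forall x, x < N -> r x < n) ->
    forall y, y < N -> update r x n y < n.+1.
  by move=> rn y yN; rewrite /update; case: eqP => // _; exact/leqW/rn.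
have updateE r n x (v : valuation) d y : (forall x, x < N -> r x < n) ->
    y < N -> update (v \o r : valuation) x d y = update v n d (update r x n y).
  move=> rn yN; rewrite /update /=; case: eqP => _; first by rewrite eqxx.
  by rewrite ltn_eqF // rn.
elim=> {a} [s t bs bt | a c _ IHa pc IHc | a c _ IHa pc IHc
  | x a xN pa IH | x t a tb xN xt bt pa IH] r n rn.
- have E := prenexable_Eq b (below_rename rn bs) (below_rename rn bt).
  by apply: prenexable_iff E => v; rewrite /= !eval_rename.
- apply: prenexable_And; [exact: IHa | exact: supp | move=> m nm].
  by apply: IHc => y /rn yn; exact: leq_trans nm.
- apply: prenexable_Or; [exact: IHa | exact: supp | move=> m nm].
  by apply: IHc => y /rn yn; exact: leq_trans nm.
- have := prenexable_exists (IH _ _ (fresh _ _ x rn)).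
  apply: prenexable_iff => v /=.
  have E d := positive_supported pa (fun y yN => updateE r n x v d y rn yN).
  by split=> -[d /E]; exists d.
- have := prenexable_forall tb (below_rename rn bt) (IH _ _ (fresh _ _ x rn)).
  apply: prenexable_iff => v /=.
  have E d := positive_supported pa (fun y yN => updateE r n x v d y rn yN).
  split=> H d; move: (H d); rewrite eval_rename (eval_update_not_occurs _ _ xt).
    by rewrite update_eq => {}H /H /E.
  by rewrite update_eq => {}H /H /E.
Qed.

Lemma positive_quantified_equation n b a : positive n b a ->
  exists qs s t, [/\ all quantifier_wf qs, b || all is_QEx qs &
    equivalent_in D a (foldr quantify (Eq s t) qs)].
Proof.
move=> /positive_prenexable/(_ id n (fun _ => id)).
by case=> [k [qs [s [t [wf _ _ _ ex spec]]]]]; exists qs, s, t.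
Qed.

(** * Sigma-formulas *)

Definition positivable (b : bool) (a : formula) : Prop :=
  exists n a', positive n b a' /\ equivalent_in D a a'.

Lemma positivable_op R op b a c : distributive R op ->
  (forall n a c, positive n b a -> positive n b c -> positive n b (op a c)) ->
  positivable b a -> positivable b c -> positivable b (op a c).
Proof.
move=> opP pop [n [a' [pa aa']]] [m [c' [pc cc']]].
exists (maxn n m), (op a' c'); split.
  apply: pop; [exact: positive_mono (leq_maxl n m) pa |].
  exact: positive_mono (leq_maxr n m) pc.
by move=> v; rewrite !(op_sat opP); exact: op_iff opP _ _ _ _ (aa' v) (cc' v).
Qed.

Lemma positivable_iff b a a' : equivalent_in D a a' ->
  positivable b a' -> positivable b a.
Proof.
move=> aa' [n [c [pc ac]]]; exists n, c; split=> // v; rewrite aa'; exact: ac.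
Qed.

Lemma positivable_And b a c : positivable b a -> positivable b c ->
  positivable b (And a c).
Proof. by apply: positivable_op distributive_And _ => n ? ?; exact: positive_And. Qed.

Lemma positivable_Or b a c : positivable b a -> positivable b c ->
  positivable b (Or a c).
Proof. by apply: positivable_op distributive_Or _ => n ? ?; exact: positive_Or. Qed.

Lemma positivable_Ex b x a : positivable b a -> positivable b (Ex x a).
Proof.
move=> [n [a' [pa aa']]]; exists (maxn n x.+1), (Ex x a'); split.
  by apply: positive_Ex; [lia | exact: positive_mono (leq_maxl _ _) pa].
by apply: (foldr_quantify_equiv [:: QEx x]).
Qed.

Lemma positivable_BAll x t a : ~~ occurs x t ->
  positivable true a -> positivable true (BAll x t a).
Proof.
move=> xt [n [a' [pa aa']]]; have [m bt] := exists_below t.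
exists (maxn (maxn n m) x.+1), (BAll x t a'); split.
  apply: positive_BAll => //; first by lia.
    by apply: below_le bt; lia.
  by apply: positive_mono pa => //; lia.
by apply: (foldr_quantify_equiv [:: QBAll x t]).
Qed.

Lemma positivable_Eq b s t : positivable b (Eq s t).
Proof.
have [n bs] := exists_below s; have [m bt] := exists_below t.
exists (maxn n m), (Eq s t); split=> //.
by apply: positive_Eq; [apply: below_le bs | apply: below_le bt]; lia.
Qed.

Lemma positivable_Prec b s t : positivable b (Prec s t).
Proof.
have [n bs] := exists_below s; have [m bt] := exists_below t.
pose x := maxn n m.
apply: (@positivable_iff _ _ (Ex x (Eq (s @@ Var x) t))); last first.
  exact/positivable_Ex/positivable_Eq.
have [nx mx] : n <= x /\ m <= x by rewrite /x; lia.
move=> v /=; split=> [/prefixP[d E] | [d]].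
  by exists d; rewrite (eval_update _ _ bs) // (eval_update _ _ bt) // update_eq.
rewrite (eval_update _ _ bs) // (eval_update _ _ bt) // => <-.
exact: prefix_prefix.
Qed.

Lemma positivable_NegPrec b s t : positivable b (Neg (Prec s t)).
Proof.
have [n bs] := exists_below s; have [m bt] := exists_below t.
pose k := maxn n m.
pose X i := Var (k + i).
pose split_at c d := And (Eq s (X 0 @@ c @@ X 1)) (Eq (t @@ X 3) (X 0 @@ d @@ X 2)).
pose a := foldr quantify (Or (split_at Cst_0 Cst_1) (split_at Cst_1 Cst_0))
  [:: QEx k; QEx k.+1; QEx k.+2; QEx k.+3].
apply: (@positivable_iff _ _ a); last first.
  do 4!apply: positivable_Ex.
  by apply: positivable_Or; apply: positivable_And; exact: positivable_Eq.
have [nk mk] : n <= k /\ m <= k by rewrite /k; lia.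
move=> v; rewrite /= not_prefixP.
do 4!apply: (ex_iff) => ?.
rewrite !(eval_update _ _ bs, eval_update _ _ bt); try lia.
by rewrite !addnS addn0 !(update_eq, update_lt); try lia.
Qed.

Lemma positivable_NegEq b s t : positivable b (Neg (Eq s t)).
Proof.
apply: (@positivable_iff _ _ (Or (Neg (Prec s t)) (Neg (Prec t s)))); last first.
  by apply: positivable_Or; exact: positivable_NegPrec.
move=> v /=; split=> [neq | [] + E]; last 2 first.
- by rewrite E prefix_refl.
- by rewrite E prefix_refl.
apply: not_and_or => -[/prefixP[x Ex] /prefixP[y]]; rewrite Ex -catA.
rewrite -[LHS]cats0 => /eqP; rewrite eqseq_cat // eqxx /= eq_sym.
by case: x Ex => // Ex _; apply: neq; rewrite Ex cats0.
Qed.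

Lemma Sigma_positivable a : Sigma a ->
  positivable true a /\ (~ contains_bounded_all a -> positivable false a).
Proof.
have sub c d : (forall x t b, subformula (BAll x t b) c ->
    subformula (BAll x t b) d) ->
    ~ contains_bounded_all d -> ~ contains_bounded_all c.
  by move=> cd nd [x [t [b [xt bc]]]]; apply: nd; exists x, t, b; split=> //; exact: cd.
elim=> {a} [s t | s t | s t | s t | a c _ [pa fa] _ [pc fc]
  | a c _ [pa fa] _ [pc fc] | x t a xt _ [pa fa] | x t a xt _ [pa fa]
  | x a _ [pa fa]].
- by split=> [|_]; exact: positivable_Prec.
- by split=> [|_]; exact: positivable_Eq.
- by split=> [|_]; exact: positivable_NegPrec.
- by split=> [|_]; exact: positivable_NegEq.
- split=> [|nb]; first exact: positivable_Or.
  apply: positivable_Or; [apply: fa | apply: fc];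
    apply: sub nb => x t b bs /=; right; by [left | right].
- split=> [|nb]; first exact: positivable_And.
  apply: positivable_And; [apply: fa | apply: fc];
    apply: sub nb => x t b bs /=; right; by [left | right].
- split=> [|nb].
    apply/positivable_Ex/positivable_And => //; exact: positivable_Prec.
  apply/positivable_Ex/positivable_And; first exact: positivable_Prec.
  by apply: fa; apply: sub nb => y u b bs /=; right; right; right.
- split=> [|nb]; first exact: positivable_BAll.
  by case: nb; exists x, t, a; split=> //; left.
- split=> [|nb]; first exact: positivable_Ex.
  by apply/positivable_Ex/fa; apply: sub nb => y u b bs /=; right.
Qed.

Lemma all_QEx_no_bounded qs s t : all is_QEx qs ->
  ~ contains_bounded_quantifier (foldr quantify (Eq s t) qs).
Proof.
move=> ex [] [x [u [b [_]]]].
  (* [BEx] is itself an [Ex], but over a conjunction, which never comes next. *)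
  by elim: qs ex => [_ [] | [y|//|//] [|[z|//|//] qs] IH /= ex [|/IH]].
by elim: qs ex => [_ [] | [y|//|//] qs IH /= ex [|/IH]] //.
Qed.

Theorem theorem11 (phi : formula) (hphi : Sigma phi) :
  exists phi' : formula,
    [/\ quantified_equation phi',
        equivalent_in D phi phi' &
        ~ contains_bounded_all phi -> ~ contains_bounded_quantifier phi'].
Proof.
have [pos ex_pos] := Sigma_positivable hphi.
have [b [exb [n [a [pa phia]]]]] : exists b : bool,
    (~ contains_bounded_all phi -> ~~ b) /\ positivable b phi.
  have [bd | nbd] := classic (contains_bounded_all phi); first by exists true.
  by exists false; split=> //; exact: ex_pos.
have [qs [s [t [wf ex eqa]]]] := positive_quantified_equation pa.
exists (foldr quantify (Eq s t) qs); split; first by exists qs, s, t.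
  by move=> v; rewrite phia; exact: eqa.
by move=> /exb/negbTE b0; rewrite b0 in ex; exact: all_QEx_no_bounded.
Qed.
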